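(* Let $\Lambda$ be a finite dimensional algebra over a field, $k\ge1$ an integer and $M$ a right $\Lambda$-module. Then $k\text{-}\operatorname{edell}M\le k\text{-}\operatorname{dell}M$.
   Context: Modules are right $\Lambda$-modules; $\mathrm{mod}\,\Lambda$ denotes the finitely generated ones. $\mathbb N$ is the set of nonnegative integers; the infimum of the empty set is $+\infty$. $\Omega M$ is the kernel of a projective cover of $M$, $\Omega^0M=M$, $\Omega^{n+1}M=\Omega(\Omega^nM)$. ''$A$ is a direct summand of $B$ up to projective summands'' means that $A$ is isomorphic to a direct summand of $B\oplus P$ for some projective $P$. $k\text{-}\operatorname{dell}M$ is the infimum of all $n\in\mathbb N$ such that $\Omega^nM$ is a direct summand of $\Omega^{n+k}N$ up to projective summands for some $N\in\mathrm{mod}\,\Lambda$. $k\text{-}\operatorname{edell}M$ is the infimum of all $n\in\mathbb N$ such that for every integer $k'\ge1$ and every right $\Lambda$-module $X$ of injective dimension $\mathrm{id}\,X=n+k-1+k'$ one has $\mathrm{Ext}_\Lambda^{n+k'}(M,X)=0$. *)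

(* Defs.v *)
From HB Require Import structures.
From mathcomp Require Import all_boot all_order all_algebra all_field.
From mathcomp Require Import boolp.

Set Implicit Arguments.
Unset Strict Implicit.
Unset Printing Implicit Defensive.

Import GRing.Theory.

Local Open Scope ring_scope.

(* N extended with +oo, the latter being represented by None. *)
Definition enat := option nat.

Definition le_enat (x y : enat) : bool :=
  match x, y with
  | _, None => true
  | None, Some _ => false
  | Some m, Some n => (m <= n)%N
  end.

Definition inf_enat (S : nat -> Prop) : enat :=
  if pselect (exists n, `[< S n >]) is left exS then Some (ex_minn exS)
  else None.

(* Left modules over a ring R. Right modules over an algebra L are obtained   *)
(* by taking R to be the converse ring L^c.                                   *)
Section Modules.
Variable R : pzRingType.
Implicit Types A B C K L M N P Q U V W X : lmodType R.

Definition surj U V (f : U -> V) : Prop := forall y, exists x, f x = y.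

Definition exact_at U V W (f : U -> V) (g : V -> W) : Prop :=
  forall y, g y = 0 <-> exists x, f x = y.

Definition mod_iso U V : Prop := exists f : {linear U -> V}, bijective f.

Definition is_zero_mod U : Prop := forall x : U, x = 0.

Definition fin_gen M : Prop :=
  exists (n : nat) (g : 'I_n -> M),
    forall x, exists c : 'I_n -> R, x = \sum_(i < n) c i *: g i.

Definition projective P : Prop :=
  forall U V (g : {linear U -> V}) (f : {linear P -> V}),
    surj g -> exists h : {linear P -> U}, forall x, g (h x) = f x.

Definition injective_mod Q : Prop :=
  forall U V (i : {linear U -> V}) (f : {linear U -> Q}),
    injective i -> exists h : {linear V -> Q}, forall x, h (i x) = f x.

Definition is_submod U (S : U -> Prop) : Prop :=
  S 0 /\ forall (a : R) x y, S x -> S y -> S (a *: x + y).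

Definition superfluous U (T : U -> Prop) : Prop :=
  forall S : U -> Prop, is_submod S ->
    (forall x, exists s t, [/\ S s, T t & x = s + t]) -> forall x, S x.

Definition projective_cover P M (p : {linear P -> M}) : Prop :=
  [/\ projective P, surj p & superfluous (fun x => p x = 0)].

(* K is (isomorphic to) the syzygy of M. As projective covers are unique up   *)
(* to isomorphism, so is K.                                                   *)
Definition is_syzygy M K : Prop :=
  exists (P : lmodType R) (p : {linear P -> M}) (i : {linear K -> P}),
    [/\ projective_cover p, injective i & exact_at i p].

Fixpoint is_nth_syzygy (n : nat) M K : Prop :=
  match n with
  | 0 => mod_iso M K
  | n'.+1 => exists L : lmodType R, is_nth_syzygy n' M L /\ is_syzygy L K
  end.

Definition is_summand A B : Prop :=
  exists C : lmodType R, mod_iso (A * C)%type B.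

Definition is_summand_upto_proj A B : Prop :=
  exists P : lmodType R, projective P /\ is_summand A (B * P)%type.

Definition dell (k : nat) M : enat :=
  inf_enat (fun n =>
    exists K : lmodType R, is_nth_syzygy n M K /\
      exists N L : lmodType R,
        [/\ fin_gen N, is_nth_syzygy (n + k)%N N L & is_summand_upto_proj K L]).

Record injective_resolution X := InjectiveResolution {
  ir_obj : nat -> lmodType R;
  ir_diff : forall n, {linear ir_obj n -> ir_obj n.+1};
  ir_coaug : {linear X -> ir_obj 0%N};
  ir_injective : forall n, injective_mod (ir_obj n);
  ir_coaug_inj : injective ir_coaug;
  ir_exact0 : exact_at ir_coaug (ir_diff 0%N);
  ir_exactS : forall n, exact_at (ir_diff n) (ir_diff n.+1)
}.

(* With this convention the zero module has injective dimension 0. *)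
Definition inj_dim X : enat :=
  inf_enat (fun m => exists I : injective_resolution X,
    forall i, (m < i)%N -> is_zero_mod (ir_obj I i)).

Record projective_resolution M := ProjectiveResolution {
  pr_obj : nat -> lmodType R;
  pr_diff : forall n, {linear pr_obj n.+1 -> pr_obj n};
  pr_aug : {linear pr_obj 0%N -> M};
  pr_projective : forall n, projective (pr_obj n);
  pr_aug_surj : surj pr_aug;
  pr_exact0 : exact_at (pr_diff 0%N) pr_aug;
  pr_exactS : forall n, exact_at (pr_diff n.+1) (pr_diff n)
}.

Definition is_cocycle M (P : projective_resolution M) X (n : nat)
    (f : {linear pr_obj P n -> X}) : Prop :=
  forall y, f (pr_diff P n y) = 0.

Definition is_coboundary M (P : projective_resolution M) X (n : nat) :
    {linear pr_obj P n -> X} -> Prop :=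
  match n with
  | 0 => fun f => forall x, f x = 0
  | m.+1 => fun f =>
      exists g : {linear pr_obj P m -> X}, forall x, f x = g (pr_diff P m x)
  end.

(* Ext^n(M, X) = 0, where Ext^n(M, X) is the n-th cohomology group of the     *)
(* complex Hom(P, X), for P a projective resolution of M; the group does not  *)
(* depend on P.                                                               *)
Definition Ext_vanishes (n : nat) M X : Prop :=
  forall (P : projective_resolution M) (f : {linear pr_obj P n -> X}),
    is_cocycle f -> is_coboundary f.

Definition edell (k : nat) M : enat :=
  inf_enat (fun n =>
    forall k' : nat, (1 <= k')%N ->
    forall X, inj_dim X = Some (n + k - 1 + k')%N ->
      Ext_vanishes (n + k')%N M X).

End Modules.

(* Main.v *)
Require Import Defs.
From HB Require Import structures.
From mathcomp Require Import all_boot all_order all_algebra all_field.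
From mathcomp Require Import boolp.

Set Implicit Arguments.
Unset Strict Implicit.
Unset Printing Implicit Defensive.

(** If [Omega^n M] is a summand of [Omega^(n+k) N + P] with [P] projective,
then for [k' >= 1] the group [Ext^(n+k')(M, X) = Ext^k'(Omega^n M, X)] is a
summand of [Ext^k'(Omega^(n+k) N, X) = Ext^(n+k+k')(N, X)], which vanishes when
[id X = n+k-1+k'].  To avoid comparing projective resolutions, the argument is
run with [Ext] computed from one injective resolution of [X] of minimal length:
there additivity in the first variable is immediate and only dimension shifting
along [0 -> Omega A -> P -> A -> 0] needs an argument. *)

Import GRing.Theory.
Local Open Scope ring_scope.

Lemma le_inf_enat (S T : nat -> Prop) :
  (forall n, S n -> T n) -> le_enat (inf_enat T) (inf_enat S).
Proof.
move=> ST; rewrite /inf_enat.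
case: (pselect (exists n, `[< S n >])) => [exS|_]; last by case: pselect.
case: pselect => [exT|nT] /=; last first.
  by case: nT; case: exS => n /asboolP Sn; exists n; apply/asboolP/ST.
case: (ex_minnP exS) => m /asboolP Sm _.
by case: (ex_minnP exT) => p _; apply; apply/asboolP/ST.
Qed.

Lemma inf_enat_attained (S : nat -> Prop) n : inf_enat S = Some n -> S n.
Proof.
by rewrite /inf_enat; case: pselect => // exS [<-]; case: ex_minnP => m /asboolP.
Qed.

Section LinearMaps.
Variable R : pzRingType.
Implicit Types A B C K P Q U V W X : lmodType R.

Lemma linear_packed U V (f : U -> V) :
  linear f -> exists g : {linear U -> V}, forall x, g x = f x.
Proof.
move=> lin_f; pose g := GRing.isLinear.Build R U V *:%R f lin_f.
by exists (HB.pack_for {linear U -> V} f g).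
Qed.

Lemma mod_iso_sym U V : mod_iso U V -> mod_iso V U.
Proof.
case=> f [g fg gf].
have [|g' g'E] := @linear_packed _ _ g.
  by move=> a x y; rewrite -{1}[x]gf -{1}[y]gf -linearP fg.
by exists g'; exists f => x; rewrite g'E.
Qed.

Lemma factor_through_injection K U V (i : {linear K -> U}) (f : {linear V -> U}) :
  injective i -> (forall x, exists y, i y = f x) ->
  exists h : {linear V -> K}, forall x, i (h x) = f x.
Proof.
move=> inj_i /choice [h ih].
have [|g gh] := @linear_packed _ _ h.
  by move=> a x y; apply: inj_i; rewrite linearP !ih linearP.
by exists g => x; rewrite gh ih.
Qed.

Lemma factor_through_surjection U V W (p : {linear U -> V}) (f : {linear U -> W}) :
  surj p -> (forall x, p x = 0 -> f x = 0) ->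
  exists h : {linear V -> W}, forall x, h (p x) = f x.
Proof.
move=> /choice [s ps] ker_f.
have fE x y : p x = p y -> f x = f y.
  move=> pxy; apply/eqP; rewrite -subr_eq0 -linearB; apply/eqP/ker_f.
  by rewrite linearB pxy subrr.
have [|g gh] := @linear_packed _ _ (f \o s).
  by move=> a x y /=; rewrite -linearP; apply: fE; rewrite linearP !ps.
by exists g => x; rewrite gh; apply: fE; rewrite ps.
Qed.

Lemma submod_packed U (S : U -> Prop) : is_submod S ->
  exists (K : lmodType R) (i : {linear K -> U}),
    injective i /\ forall y, S y <-> exists x, i x = y.
Proof.
case=> S0 SP.
pose s : {pred U} := fun x => `[< S x >].
have sP : submod_closed s.
  split=> [|a x y /asboolP Sx /asboolP Sy]; apply/asboolP => //; exact: SP.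
pose K := HB.pack_for (lmodType R) {x : U | s x}
  (GRing.SubChoice_isSubLmodule.Build R U s {x : U | s x} sP).
have lin_val : linear (val : K -> U) by [].
have [i iE] := linear_packed lin_val.
exists K, i; split=> [x y|y]; first by rewrite !iE => /val_inj.
split=> [Sy|[x <-]]; last by rewrite iE; apply/asboolP/(valP x).
have sy : s y by apply/asboolP.
by exists (exist _ y sy : K); rewrite iE.
Qed.

Lemma exact_comp0 U V W (f : {linear U -> V}) (g : {linear V -> W}) x :
  exact_at f g -> g (f x) = 0.
Proof. by move=> fg; apply/fg; exists x. Qed.

Lemma projective_lift_exact P U V W (g : {linear U -> V}) (h : {linear V -> W})
    (f : {linear P -> V}) :
  projective P -> exact_at g h -> (forall x, h (f x) = 0) ->
  exists e : {linear P -> U}, forall x, g (e x) = f x.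
Proof.
move=> projP gh hf0.
have [|K [i [inj_i iE]]] := @submod_packed V (fun y => h y = 0).
  by split=> [|a x y hx hy]; rewrite ?linear0 // linearP hx hy scaler0 addr0.
have [|g' g'E] := factor_through_injection (f := g) inj_i.
  by move=> x; apply/iE; apply: exact_comp0 gh.
have [|f' f'E] := factor_through_injection (f := f) inj_i.
  by move=> x; apply/iE.
have [|e eE] := projP _ _ g' f'.
  move=> y; have /gh [x gx] : h (i y) = 0 by apply/iE; exists y.
  by exists x; apply: inj_i; rewrite g'E.
by exists e => x; rewrite -g'E eE f'E.
Qed.

Lemma is_submod_image U V (f : {linear U -> V}) :
  is_submod (fun y => exists x, f x = y).
Proof.
split=> [|a _ _ [x <-] [y <-]]; first by exists 0; rewrite linear0.
by exists (a *: x + y); rewrite linearP.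
Qed.

Lemma first_syzygy A (Q : projective_resolution A) :
  exists (K : lmodType R) (i : {linear K -> pr_obj Q 0})
    (d : {linear pr_obj Q 1 -> K}),
  [/\ injective i, exact_at i (pr_aug Q), surj d, exact_at (pr_diff Q 1) d &
      forall x, i (d x) = pr_diff Q 0 x].
Proof.
have [K [i [inj_i iE]]] := submod_packed (is_submod_image (pr_diff Q 0)).
have [|d dE] := factor_through_injection (f := pr_diff Q 0) inj_i.
  by move=> x; apply/iE; exists x.
exists K, i, d; split=> // y.
- exact: iff_trans (pr_exact0 y) (iE y).
- have /iE [x xy] : exists z, i z = i y by exists y.
  by exists x; apply: inj_i; rewrite dE.
- apply: iff_trans (pr_exactS y); rewrite -dE.
  by split=> [->|]; [rewrite linear0 | rewrite -[X in _ = X](linear0 i) => /inj_i].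
Qed.

End LinearMaps.

Section InjectiveExt.
Variables (R : pzRingType) (X : lmodType R) (I : injective_resolution X).
Implicit Types A B K P W : lmodType R.

(* [Ext^(n+1)(A, X) = 0], computed as the cohomology of [Hom(A, I)]. *)
Definition inj_Ext_vanishes n A : Prop :=
  forall f : {linear A -> ir_obj I n.+1},
    (forall x, ir_diff I n.+1 (f x) = 0) ->
    exists g : {linear A -> ir_obj I n}, forall x, ir_diff I n (g x) = f x.

Lemma inj_Ext_vanishes_zero n A :
  is_zero_mod (ir_obj I n.+1) -> inj_Ext_vanishes n A.
Proof.
by move=> I0 f _; exists \0 => x; rewrite linear0 [RHS]I0.
Qed.

Lemma inj_Ext_vanishes_retract n A B (i : {linear A -> B}) (r : {linear B -> A}) :
  cancel i r -> inj_Ext_vanishes n B -> inj_Ext_vanishes n A.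
Proof.
move=> ir EB f df; have [|g dg] := EB (f \o r); first by move=> x /=.
by exists (g \o i) => x /=; rewrite dg /= ir.
Qed.

Lemma inj_Ext_vanishes_iso n A B :
  mod_iso A B -> inj_Ext_vanishes n A -> inj_Ext_vanishes n B.
Proof.
case=> f [g fg gf].
have [|g' g'E] := @linear_packed _ _ _ g.
  by move=> a x y; rewrite -{1}[x]gf -{1}[y]gf -linearP fg.
by apply: (inj_Ext_vanishes_retract (i := g') (r := f)) => x; rewrite g'E gf.
Qed.

Lemma inj_Ext_vanishes_summand_upto_proj n A B :
  is_summand_upto_proj A B -> inj_Ext_vanishes n B -> inj_Ext_vanishes n A.
Proof.
case=> P [projP [C [phi bij_phi]]] EB.
have EBP : inj_Ext_vanishes n (B * P)%type.
  move=> f df.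
  have [|iB iBE] := @linear_packed _ B (B * P)%type (fun b => (b, 0)).
    by move=> a x y; rewrite -[RHS]/(_, _) /= scaler0 addr0.
  have [|iP iPE] := @linear_packed _ P (B * P)%type (fun p => (0, p)).
    by move=> a x y; rewrite -[RHS]/(_, _) /= scaler0 addr0.
  have [|gB gBE] := EB (f \o iB); first by move=> x /=.
  have [|gP gPE] := projective_lift_exact (f := f \o iP) projP
    (@ir_exactS _ _ I n).
    by move=> x /=.
  exists ((gB \o fst) \+ (gP \o snd)) => -[b p] /=.
  rewrite linearD gBE gPE /= -linearD iBE iPE; congr (f _).
  by rewrite -[LHS]/(_, _) /= addr0 add0r.
have EAC : inj_Ext_vanishes n (A * C)%type.
  by apply: inj_Ext_vanishes_iso EBP; apply: mod_iso_sym; exists phi.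
have [|iA iAE] := @linear_packed _ A (A * C)%type (fun a => (a, 0)).
  by move=> a x y; rewrite -[RHS]/(_, _) /= scaler0 addr0.
by apply: (inj_Ext_vanishes_retract (i := iA) (r := fst)) EAC => x; rewrite iAE.
Qed.

Section DimensionShift.
Variables (A K P : lmodType R) (i : {linear K -> P}) (p : {linear P -> A}).
Hypotheses (projP : projective P) (surj_p : surj p).
Hypotheses (inj_i : injective i) (exact_ip : exact_at i p).

Lemma factor_through_coker W (f : {linear P -> W}) :
  (forall x, f (i x) = 0) -> exists h : {linear A -> W}, forall x, h (p x) = f x.
Proof.
move=> fi0; apply: factor_through_surjection => // x /exact_ip [y <-].
exact: fi0.
Qed.

Lemma inj_Ext_vanishes_syzygy n :
  inj_Ext_vanishes n.+1 A -> inj_Ext_vanishes n K.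
Proof.
move=> EA f df.
have [f' f'i] := ir_injective (i := I) f inj_i.
have [|e ep] := factor_through_coker (f := ir_diff I n.+1 \o f').
  by move=> x /=; rewrite f'i.
have [|g dg] := EA e.
  move=> y; have [x <-] := surj_p y.
  by rewrite ep; apply: exact_comp0 (@ir_exactS _ _ _ _).
have [|h dh] := projective_lift_exact (f := f' \- (g \o p)) projP
  (@ir_exactS _ _ I n).
  by move=> x /=; rewrite linearB dg ep subrr.
exists (h \o i) => x /=.
by rewrite dh /= f'i (exact_comp0 _ exact_ip) linear0 subr0.
Qed.

Lemma inj_Ext_vanishes_cosyzygy n :
  inj_Ext_vanishes n K -> inj_Ext_vanishes n.+1 A.
Proof.
move=> EK f df.
have [|h dh] := projective_lift_exact (f := f \o p) projP
  (@ir_exactS _ _ I n.+1).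
  by move=> x /=.
have [|g dg] := EK (h \o i).
  by move=> x /=; rewrite dh /= (exact_comp0 _ exact_ip) linear0.
have [g' g'i] := ir_injective (i := I) g inj_i.
have [|e ep] := factor_through_coker (f := h \- (ir_diff I n \o g')).
  by move=> x /=; rewrite g'i dg subrr.
exists e => y; have [x <-] := surj_p y; rewrite ep /= linearB dh /=.
by rewrite (exact_comp0 _ (@ir_exactS _ _ _ _)) subr0.
Qed.

Lemma extend_of_inj_Ext_vanishes0 (f : {linear K -> X}) :
  inj_Ext_vanishes 0 A -> exists g : {linear P -> X}, forall x, g (i x) = f x.
Proof.
move=> EA; pose c := ir_coaug I.
have [h hi] := ir_injective (i := I) (c \o f) inj_i.
have [|e ep] := factor_through_coker (f := ir_diff I 0 \o h).
  by move=> x /=; rewrite hi; apply: exact_comp0 (@ir_exact0 _ _ I).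
have [|g dg] := EA e.
  move=> y; have [x <-] := surj_p y.
  by rewrite ep; apply: exact_comp0 (@ir_exactS _ _ _ _).
have [|u cu] := factor_through_injection (f := h \- (g \o p))
  (ir_coaug_inj (i := I)).
  by move=> x; apply/ir_exact0; rewrite /= linearB dg ep subrr.
exists u => x; apply: (ir_coaug_inj (i := I)); rewrite cu /=.
by rewrite hi (exact_comp0 _ exact_ip) linear0 subr0.
Qed.

End DimensionShift.

Lemma inj_Ext_vanishes_nth_syzygy m n A K : is_nth_syzygy m A K ->
  inj_Ext_vanishes (m + n) A <-> inj_Ext_vanishes n K.
Proof.
elim: m n K => [|m IH] n K /=.
  by move=> AK; split; apply: inj_Ext_vanishes_iso => //; apply: mod_iso_sym.
case=> L [AL [P [p [i [[projP surj_p _] inj_i exact_ip]]]]].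
rewrite addSnnS; apply: iff_trans (IH n.+1 L AL) _; split.
  exact: inj_Ext_vanishes_syzygy surj_p inj_i exact_ip _.
exact: inj_Ext_vanishes_cosyzygy surj_p inj_i exact_ip _.
Qed.

Lemma Ext_vanishes_inj n A : inj_Ext_vanishes n A -> Ext_vanishes n.+1 A X.
Proof.
elim: n A => [|n IH] A EA Q f cocycle_f;
  have [K [i [d [inj_i exact_i surj_d exact_d dE]]]] := first_syzygy Q.
- have [|f' f'E] := factor_through_surjection (f := f) surj_d.
    by move=> x /exact_d [y <-]; apply: cocycle_f.
  have [g gE] :=
    extend_of_inj_Ext_vanishes0 (@pr_aug_surj _ _ Q) inj_i exact_i f' EA.
  by exists g => x; rewrite -dE gE f'E.
- pose Q' := @ProjectiveResolution _ K (fun m => pr_obj Q m.+1)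
    (fun m => pr_diff Q m.+1) d (fun m => @pr_projective _ _ Q m.+1) surj_d
    exact_d (fun m => @pr_exactS _ _ Q m.+1).
  have EK := inj_Ext_vanishes_syzygy (@pr_projective _ _ Q 0)
    (@pr_aug_surj _ _ Q) inj_i exact_i EA.
  exact: (IH K EK Q' f cocycle_f).
Qed.

End InjectiveExt.

Theorem lemma2p10 (F : fieldType) (Lambda : falgType F) (k : nat)
    (k_ge1 : (1 <= k)%N) (M : lmodType Lambda^c) :
  le_enat (edell k M) (dell k M).
Proof.
apply: le_inf_enat => n [K [MK [N [L [_ NL KL]]]]] [//|k'] _ X.
move=> /inf_enat_attained [I I0].
rewrite addnS; apply: (@Ext_vanishes_inj _ _ I).
apply/(inj_Ext_vanishes_nth_syzygy I k' MK).
apply: inj_Ext_vanishes_summand_upto_proj KL _.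
apply/(inj_Ext_vanishes_nth_syzygy I k' NL).
apply: inj_Ext_vanishes_zero; apply: I0.
by rewrite addnS ltnS -addSn subn1 prednK ?leq_add2r // addn_gt0 k_ge1 orbT.
Qed.
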